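(* Let $(X,T)$ and $(Y,T)$ be minimal compact metrizable dynamical systems, let $\pi\colon (X,T)\to(Y,T)$ be an almost one-to-one extension of type cc, and let $\pi_*\colon E(X)\to E(Y)$ be the induced surjective homomorphism. Suppose $p\in E(X)$ satisfies: (a) $E(Y)$ is first countable at $\pi_*(p)$; (b) the preimage $\pi_*(p)^{-1}(y)=\{z\in Y:\pi_*(p)(z)=y\}$ is at most countable for every $y\in Y$. Then $E(X,T)$ is first countable at $p$. Furthermore, if conditions (a) and (b) hold for every $p\in E(X)$, then $(X,T)$ is tame$_{\mathbf 1}$.
   Context: A dynamical system $(X,T)$ is a compact Hausdorff space $X$ with a continuous homomorphism $j\colon T\to \mathrm{Homeo}(X)$ from a topological group $T$. Its enveloping semigroup $E(X)=E(X,T)$ is the closure of $j(T)$ in $X^X$ with the pointwise topology. A compact metrizable system is tame$_{\mathbf 1}$ if $E(X,T)$ is first countable. A factor map $\pi\colon X\to Y$ is a continuous $T$-equivariant surjection; it induces a unique continuous surjective semigroup homomorphism $\pi_*\colon E(X)\to E(Y)$ with $\pi\circ p=\pi_*(p)\circ\pi$ for all $p\in E(X)$. For a factor map $\pi$ of minimal metrizable systems let $X_0=\{x\in X:\pi^{-1}(\pi(x))=\{x\}\}$. $\pi$ is an almost one-to-one extension if $X_0$ is a dense $G_\delta$ subset of $X$. An almost one-to-one extension is of type cc if $X\setminus X_0$ is countable. *)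

(* Defs.v *)
From HB Require Import structures.
From mathcomp Require Import all_boot all_order all_algebra.
From mathcomp Require Import all_classical all_reals all_analysis.
From mathcomp Require Import borel_hierarchy.

Set Implicit Arguments.
Unset Strict Implicit.
Unset Printing Implicit Defensive.

Local Open Scope classical_set_scope.
Local Open Scope group_scope.

HB.mixin Record Group_isTopologicalGroup G & Topological G & Group G := {
  mulg_continuous : continuous (fun x : G * G => x.1 * x.2) ;
  invg_continuous : continuous (fun x : G => x^-1)
}.

#[short(type="topologicalGroupType")]
HB.structure Definition TopologicalGroup :=
  {G of Topological G & Group G & Group_isTopologicalGroup G}.

Definition homeomorphism (X Y : topologicalType) (f : X -> Y) :=
  continuous f /\ exists g : Y -> X, [/\ continuous g, cancel f g & cancel g f].

(* Homeo(X) carries the compact-open topology, which for compact Hausdorff X is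
   the topology of uniform convergence. *)
Definition homeo_group (X : topologicalType) : topologicalType :=
  set_type [set f : {compact-open, X -> X} | homeomorphism (f : X -> X)].

Definition homeo_fun (X : topologicalType) (h : homeo_group X) : X -> X :=
  set_val h.

Record dynamical_system (T : topologicalGroupType) (X : topologicalType) :=
  DynamicalSystem {
  ds_hom : T -> homeo_group X ;
  ds_compact : compact [set: X] ;
  ds_hausdorff : hausdorff_space X ;
  ds_continuous : continuous ds_hom ;
  ds_morph : forall s t : T,
    homeo_fun (ds_hom (s * t)) = homeo_fun (ds_hom s) \o homeo_fun (ds_hom t)
}.

Definition action (T : topologicalGroupType) (X : topologicalType)
  (D : dynamical_system T X) (t : T) : X -> X := homeo_fun (ds_hom D t).

(* No nonemptiness requirement: the empty system counts as minimal. *)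
Definition minimal_system (T : topologicalGroupType) (X : topologicalType)
    (D : dynamical_system T X) :=
  forall A : set X, closed A -> (forall t, action D t @` A `<=` A) ->
    A = set0 \/ A = setT.

Definition metrizable (R : realType) (X : topologicalType) :=
  exists (M : metricType R) (f : X -> M), homeomorphism f.

Definition enveloping_set (T : topologicalGroupType) (X : topologicalType)
    (D : dynamical_system T X) : set {ptws X -> X} :=
  closure (range (action D) : set {ptws X -> X}).

Definition enveloping (T : topologicalGroupType) (X : topologicalType)
  (D : dynamical_system T X) : topologicalType := set_type (enveloping_set D).

Definition env_fun (T : topologicalGroupType) (X : topologicalType)
  (D : dynamical_system T X) (p : enveloping D) : X -> X := set_val p.

Definition first_countable_at (Z : topologicalType) (z : Z) :=
  exists B : set (set Z), [/\ countable B, B `<=` nbhs z &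
    forall U, nbhs z U -> exists2 V, B V & V `<=` U].

Definition first_countable (Z : topologicalType) :=
  forall z : Z, first_countable_at z.

Definition tame1 (R : realType) (T : topologicalGroupType) (X : topologicalType)
    (D : dynamical_system T X) :=
  metrizable R X /\ first_countable (enveloping D).

Definition factor_map (T : topologicalGroupType) (X Y : topologicalType)
    (D : dynamical_system T X) (F : dynamical_system T Y) (f : X -> Y) :=
  [/\ continuous f, range f = setT &
      forall t x, f (action D t x) = action F t (f x)].

Definition injectivity_points (X Y : Type) (f : X -> Y) : set X :=
  [set x | f @^-1` [set f x] = [set x]].

Definition almost_one_to_one (T : topologicalGroupType) (X Y : topologicalType)
    (D : dynamical_system T X) (F : dynamical_system T Y) (f : X -> Y) :=
  [/\ factor_map D F f, dense (injectivity_points f) &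
      Gdelta (injectivity_points f)].

Definition type_cc (X Y : topologicalType) (f : X -> Y) :=
  countable (~` injectivity_points f).

Section enveloping_semigroup.
Context (T : topologicalGroupType).

Lemma ptws_eval_continuous (X Y : topologicalType) (x : X) :
  continuous (fun f : {ptws X -> Y} => f x).
Proof. exact: (@proj_continuous X (fun=> Y) x). Qed.

Lemma ptws_continuous (Z X Y : topologicalType) (f : Z -> {ptws X -> Y}) :
  (forall x, continuous (fun z => f z x)) -> continuous f.
Proof.
move=> cf z; apply/cvg_sup => x U [V [[W oW <-] Vfz VU]].
apply: (filterS VU); apply: cf.
by apply: open_nbhs_nbhs.
Qed.

Lemma closure_image_sub (Z W : topologicalType) (f : Z -> W) (A : set Z)
    (B : set W) : continuous f -> f @` A `<=` B -> f @` closure A `<=` closure B.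
Proof.
move=> cf fAB _ [z clz <-] U /cf /clz [a [Aa Ua]].
by exists (f a); split => //; apply: fAB; exists a.
Qed.

Lemma action_continuous (X : topologicalType) (D : dynamical_system T X) t :
  continuous (action D t).
Proof. by have /set_mem [] := valP (ds_hom D t). Qed.

Lemma enveloping_comp_subproof (X : topologicalType) (D : dynamical_system T X)
    (p q : enveloping D) : env_fun p \o env_fun q \in enveloping_set D.
Proof.
apply/mem_set; set E := enveloping_set D.
have Eq : E (env_fun q) by exact: set_valP.
have Ep : E (env_fun p) by exact: set_valP.
have clE : closure E `<=` E by exact: closed_closure.
apply: clE.
apply: (@closure_image_sub _ _
  ((fun f => f \o env_fun q) : {ptws X -> X} -> {ptws X -> X}) (range (action D))).
- by apply: ptws_continuous => x; exact: ptws_eval_continuous.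
- move=> _ [_ [t _ <-] <-].
  apply: (@closure_image_sub _ _
    ((fun f => action D t \o f) : {ptws X -> X} -> {ptws X -> X}) (range (action D))).
  + apply: ptws_continuous => x f.
    apply: (@continuous_comp _ _ _ (fun f : {ptws X -> X} => f x)).
      exact: ptws_eval_continuous.
    exact: action_continuous.
  + move=> _ [_ [s _ <-] <-]; exists (t * s) => //.
    exact: ds_morph.
  + by exists (env_fun q).
- by exists (env_fun p).
Qed.

Definition enveloping_comp (X : topologicalType) (D : dynamical_system T X)
    (p q : enveloping D) : enveloping D :=
  SigSub (enveloping_comp_subproof p q).

(* The last condition alone determines fs; existence and uniqueness are
   induced_hom_exists below. *)
Definition induced_hom (X Y : topologicalType) (D : dynamical_system T X)
    (F : dynamical_system T Y) (f : X -> Y)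
    (fs : enveloping D -> enveloping F) :=
  [/\ continuous fs, range fs = setT,
      {morph fs : p q / enveloping_comp p q} &
      forall p, f \o env_fun p = env_fun (fs p) \o f].

Lemma induced_hom_exists (X Y : topologicalType) (D : dynamical_system T X)
    (F : dynamical_system T Y) (f : X -> Y) :
  factor_map D F f -> exists! fs, induced_hom (D := D) (F := F) f fs.
Proof.
move=> [cf sf eqf].
have /choice[s fs] : forall y, exists x, f x = y.
  by move=> y; have /= [x _ <-] : (range f) y; [rewrite sf | exists x].
pose Phi (g : {ptws X -> X}) : {ptws Y -> Y} := fun y => f (g (s y)).
have cPhi : continuous Phi.
  apply: ptws_continuous => y g.
  apply: (@continuous_comp _ _ _ (fun g : {ptws X -> X} => g (s y))).
    exact: ptws_eval_continuous.
  exact: cf.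
have PhiE p : enveloping_set D p -> Phi p \in enveloping_set F.
  move=> Ep; apply/mem_set.
  apply: (@closure_image_sub _ _ Phi (range (action D))) => //.
  move=> _ [_ [t _ <-] <-]; exists t => //; apply/funext => y.
  by rewrite /Phi eqf fs.
have PhiK p x : enveloping_set D p -> f (p x) = Phi p (f x).
  move=> Ep; apply: (ds_hausdorff F) => U V nU nV.
  have nU' : nbhs p [set g : {ptws X -> X} | U (f (g x))].
    exact: (@ptws_eval_continuous X X x p) (cf _ _ nU).
  have nV' : nbhs p [set g : {ptws X -> X} | V (Phi g (f x))].
    exact: (cPhi p) (@ptws_eval_continuous Y Y (f x) (Phi p) _ nV).
  have [_ [[t _ <-] [/= Ut Vt]]] := Ep _ (filterI nU' nV').
  exists (f (action D t x)); split => //.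
  by move: Vt; rewrite /Phi eqf fs -eqf.
pose h (p : enveloping D) : enveloping F := SigSub (PhiE _ (set_valP p)).
have hE p : f \o env_fun p = env_fun (h p) \o f.
  by apply/funext => x; apply: PhiK; exact: set_valP.
have huniq (g : enveloping D -> enveloping F) :
    (forall p, f \o env_fun p = env_fun (g p) \o f) -> h = g.
  move=> gE; apply/funext => p; apply/val_inj/funext => y.
  rewrite -(fs y); have := hE p; rewrite gE => /(congr1 (@^~ (s y))).
  exact: esym.
have ch : continuous h.
  apply: continuous_comp_initial.
  have := @initial_continuous (enveloping D) _ set_val.
  move=> cval p; apply: (@continuous_comp _ _ _ set_val Phi); last exact: cPhi.
  exact: cval.
exists h; split; last by move=> g [_ _ _ /huniq].
split => //.
- apply/seteqP; split => // q _.
  have : enveloping_set F (env_fun q) by exact: set_valP.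
  suff clPhi : closed (Phi @` enveloping_set D).
    move=> Eq; have : (Phi @` enveloping_set D) (env_fun q).
      apply: clPhi; apply: closureS Eq => _ [t _ <-].
      exists (action D t); first by apply: subset_closure; exists t.
      by apply/funext => y; rewrite /Phi eqf fs.
    move=> [p Ep pq]; exists (SigSub (mem_set Ep)) => //.
    by apply/val_inj; rewrite -[RHS]pq.
  apply: compact_closed.
    exact: (@hausdorff_product Y (fun=> Y) (fun=> ds_hausdorff F)).
  apply: continuous_compact; first exact: continuous_subspaceT.
  apply: (subclosed_compact (B := setT)) => //; first exact: closed_closure.
  have := @tychonoff X (fun=> X) (fun=> setT) (fun=> ds_compact D).
  congr compact; exact/seteqP.
- move=> p q; apply/val_inj/funext => y /=.
  rewrite /Phi /=.
  have /(congr1 (@^~ (env_fun q (s y)))) /= := hE p.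
  by [].
Qed.

End enveloping_semigroup.

(* Main.v *)
Require Import Defs.
From mathcomp Require Import all_boot all_order all_algebra.
From mathcomp Require Import all_classical all_reals all_analysis.

Set Implicit Arguments.
Unset Strict Implicit.
Unset Printing Implicit Defensive.

Local Open Scope classical_set_scope.

(** The proof exhibits countably many neighbourhoods of p that generate the
    neighbourhood filter of p.  Let q = fs p, let Z be the set of points of X
    that are not alone in their fibre, and let
<<
      A = { x | f (p x) lies in f(Z) } = f^-1 (q^-1 (f(Z))).
>>
    The set Z is countable and its complement is a union of singleton fibres,
    so f has countable fibres; as q has countable fibres too, A is countable.

    In the pointwise topology, g is close to p when g x is close to p x for
    finitely many x in X.  At the points x of A this is imposed directly, by
    a countable base of neighbourhoods of p x, which exists because X is
    metrizable.  If x is outside A, then p x is alone in its fibre, and since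
    f is a closed map, each neighbourhood of p x contains the preimage of a
    neighbourhood of f (p x) = q (f x) ([injectivity_point_nbhs]).  Because
    f (g x) = fs g (f x), it is then enough that fs g be close to q, and one
    countable base at q serves all these x at once.  So the conditions at the
    points of A, together with the preimages under fs of a countable base
    at q, generate the neighbourhoods of p
    ([first_countable_at_enveloping]). *)

(** Being a local subbase is phrased through the filters containing [C], so
    that it can be checked as a convergence.  The finite intersections of
    members of [C] are the countable base. *)
Lemma first_countable_at_subbase (Z : topologicalType) (z : Z)
    (C : set (set Z)) :
  countable C -> C `<=` nbhs z ->
  (forall G : set_system Z, Filter G -> C `<=` G -> G --> z) ->
  first_countable_at z.
Proof.
move=> cC Cz Cgen; exists (finI_from C id).
have genE : filter_from (finI_from C id) id = smallest (@Filter Z) C.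
  by rewrite smallest_filter_finI image_id.
split; first exact: finI_from_countable.
- move=> B BC; have : filter_from (finI_from C id) id B by exists B.
  by rewrite genE; apply; split => //; exact: nbhs_filter.
- have FC : Filter (filter_from (finI_from C id) id).
    by rewrite genE; exact: smallest_filter_filter.
  by apply: Cgen => B CB; exists B => //; exact: (finI_from1 id CB).
Qed.

Lemma first_countable_uniform (M : uniformType) :
  countable_uniformity M -> first_countable M.
Proof.
move=> /countable_uniformityP[E Egen Eent] x.
exists (range (fun n => xsection (E n) x)); split.
- exact: sub_countable (card_image_le _ _) (countableP _).
- by move=> _ [n _ <-]; exact: nbhs_entourage.
- move=> U /nbhsP[A /Egen[n EnA] AU].
  exists (xsection (E n) x); first by exists n.
  by move=> y /xsectionP Exy; apply/AU/xsectionP/EnA.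
Qed.

Lemma first_countable_metrizable (R : realType) (X : topologicalType) :
  metrizable R X -> first_countable X.
Proof.
move=> [M [h [ch [k [ck hK kK]]]]] x.
have [B [cB Bh genB]] :=
  first_countable_uniform (countable_uniformity_metric (R := R)) (h x).
exists ((fun V => h @^-1` V) @` B); split.
- exact: sub_countable (card_image_le _ _) cB.
- by move=> _ [V BV <-]; apply: ch; exact: Bh.
- move=> U xU; have : nbhs (h x) (k @^-1` U) by apply: ck; rewrite hK.
  move=> /genB[V BV VU]; exists (h @^-1` V); first by exists V.
  by move=> y /VU /=; rewrite hK.
Qed.

(** The image of the complement of an open neighbourhood of [x] is closed,
    by compactness, and misses [f x], because [x] is alone in its fibre. *)
Lemma injectivity_point_nbhs (X Y : topologicalType) (f : X -> Y) (x : X)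
    (U : set X) :
  compact [set: X] -> hausdorff_space Y -> continuous f ->
  injectivity_points f x -> nbhs x U ->
  exists2 V, nbhs (f x) V & f @^-1` V `<=` U.
Proof.
move=> cX hY cf injx; rewrite nbhsE => -[V [oV Vx] VU].
exists (~` (f @` (~` V))); last first.
  by move=> y /= nfVy; apply: VU; apply: contrapT => nVy; apply: nfVy; exists y.
apply: open_nbhs_nbhs; split.
  apply/closed_openC; apply: compact_closed => //; apply: continuous_compact.
    exact: continuous_subspaceT.
  by apply: (subclosed_compact _ cX) => //; exact: open_closedC.
move=> [y nVy fyx]; apply: nVy.
by have : (f @^-1` [set f x]) y by []; rewrite injx => ->.
Qed.

(** A fibre that meets the injectivity points is a singleton; any other lies
    in their countable complement. *)
Lemma type_cc_countable_fiber (X Y : topologicalType) (f : X -> Y) (y : Y) :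
  type_cc f -> countable (f @^-1` [set y]).
Proof.
move=> ccf.
have [[x [fx <-]]|nox] := pselect (exists x, injectivity_points f x /\ f x = y).
  by rewrite fx; exact: countable1.
apply: sub_countable ccf; apply: subset_card_le => x fxy fx.
by apply: nox; exists x.
Qed.

Lemma countable_preimage (S V : Type) (f : S -> V) (B : set V) :
  countable B -> (forall y, countable (f @^-1` [set y])) ->
  countable (f @^-1` B).
Proof.
move=> cB cf; have -> : f @^-1` B = \bigcup_(y in B) f @^-1` [set y].
  by apply/seteqP; split=> [x Bx|x [y By /= ->]//]; exists (f x).
exact: bigcup_countable.
Qed.

Section EnvelopingTopology.
Context (T : topologicalGroupType) (X : topologicalType).
Variable D : dynamical_system T X.

Lemma env_fun_continuous (x : X) :
  continuous (fun g : enveloping D => env_fun g x).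
Proof.
move=> g; apply: (@continuous_comp _ _ _
  (set_val : enveloping D -> {ptws X -> X})
  (fun h : {ptws X -> X} => h x)).
  exact: initial_continuous.
exact: ptws_eval_continuous.
Qed.

Lemma enveloping_cvg (G : set_system (enveloping D)) (p : enveloping D) :
  Filter G -> (forall x, env_fun g x @[g --> G] --> env_fun p x) -> G --> p.
Proof.
move=> FG Gp.
have cG : (set_val g : {ptws X -> X}) @[g --> G] --> (set_val p : {ptws X -> X}).
  apply/cvg_sup => x U [V [[W oW <-] Wpx WU]].
  apply: (filterS WU); apply: Gp.
  exact: open_nbhs_nbhs.
move=> U [V [[W oW <-] Wp WU]].
apply: (filterS WU); apply: cG.
exact: open_nbhs_nbhs.
Qed.

End EnvelopingTopology.

Lemma first_countable_at_enveloping (T : topologicalGroupType)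
    (X Y : topologicalType)
    (D : dynamical_system T X) (F : dynamical_system T Y) (f : X -> Y)
    (fs : enveloping D -> enveloping F) (p : enveloping D) :
  first_countable X -> continuous f -> type_cc f -> continuous fs ->
  (forall g, f \o env_fun g = env_fun (fs g) \o f) ->
  first_countable_at (fs p) ->
  (forall y : Y, countable [set z | env_fun (fs p) z = y]) ->
  first_countable_at p.
Proof.
move=> fcX cf ccf cfs fsE [B [cB Bq genB]] cq.
have {}fsE g x : f (env_fun g x) = env_fun (fs g) (f x).
  by have /(congr1 (@^~ x)) := fsE g.
pose A := f @^-1` (env_fun (fs p) @^-1` (f @` (~` injectivity_points f))).
have cA : countable A.
  apply: countable_preimage => [|y]; last exact: type_cc_countable_fiber.
  apply: countable_preimage => //.
  exact: sub_countable (card_image_le _ _) ccf.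
have [N Nbase] := choice (fun x : X => fcX x).
pose C := (fun V => fs @^-1` V) @` B `|`
  \bigcup_(x in A) (fun V => [set g | V (env_fun g x)]) @` N (env_fun p x).
apply: (@first_countable_at_subbase _ p C).
- rewrite /C -bigcup2E; apply: bigcup_countable => // -[|[|n]] _ //=.
    exact: sub_countable (card_image_le _ _) cB.
  apply: bigcup_countable => // x _.
  have [cN _ _] := Nbase (env_fun p x).
  exact: sub_countable (card_image_le _ _) cN.
- move=> _ [[V BV <-]|[x _ [V NV <-]]]; first by apply: cfs; exact: Bq.
  have [_ + _] := Nbase (env_fun p x).
  by move=> /(_ _ NV); exact: env_fun_continuous.
move=> G FG CG; apply: enveloping_cvg => x U pxU.
have [Ax|nAx] := pselect (A x).
  have [_ _ /(_ _ pxU)[V NV VU]] := Nbase (env_fun p x).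
  apply: (@filterS _ G _ [set g | V (env_fun g x)]); first by move=> g /VU.
  by apply: CG; right; exists x => //; exists V.
have injpx : injectivity_points f (env_fun p x).
  by apply: contrapT => ninj; apply: nAx; exists (env_fun p x).
have [W fpxW WU] :=
  injectivity_point_nbhs (ds_compact D) (ds_hausdorff F) cf injpx pxU.
have /genB[V BV VW] : nbhs (fs p) [set h | W (env_fun h (f x))].
  by apply: env_fun_continuous; rewrite -fsE.
apply: (@filterS _ G _ (fs @^-1` V)).
  by move=> g /VW /= Wg; apply: WU; rewrite /= fsE.
by apply: CG; left; exists V.
Qed.

Theorem theorem2p3 (R : realType) (T : topologicalGroupType)
    (X Y : topologicalType)
    (D : dynamical_system T X) (F : dynamical_system T Y)
    (metrX : metrizable R X) (metrY : metrizable R Y)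
    (minX : minimal_system D) (minY : minimal_system F)
    (f : X -> Y) (f_aoo : almost_one_to_one D F f) (f_cc : type_cc f)
    (fs : enveloping D -> enveloping F) (fs_ind : induced_hom f fs) :
  (forall p : enveloping D,
     first_countable_at (fs p) ->
     (forall y : Y, countable [set z | env_fun (fs p) z = y]) ->
     first_countable_at p) /\
  ((forall p : enveloping D,
      first_countable_at (fs p) /\
      (forall y : Y, countable [set z | env_fun (fs p) z = y])) ->
   tame1 R D).
Proof.
have fcX := first_countable_metrizable metrX.
have [[cf _ _] _ _] := f_aoo.
have [cfs _ _ fsE] := fs_ind.
have fcp p := first_countable_at_enveloping (p := p) fcX cf f_cc cfs fsE.
split; first exact: fcp.
by move=> fcq; split => // p; have [/fcp] := fcq p; apply.
Qed.
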